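(* Over the real scalar field, $\rho^+(\ell_\infty^2(\mathbb{R}))=1$ and $\rho^+(\ell_\infty^3(\mathbb{R}))=\frac{5}{4}$.
   Context: For a finite-dimensional real normed space $X$ with basis $e_1,\dots,e_n$ (the canonical basis when $X=\ell_\infty^n(\mathbb R)$), an element $A=\sum_{i,j}a_{ij}\,e_i\otimes e_j\in X\otimes X$ is called non-negative definite, written $A\ge 0$, if the matrix $(a_{ij})$ is (symmetric) non-negative definite. The injective norm is $\|A\|_\epsilon=\sup\{\|A(\lambda)\|_X:\lambda\in X^*,\ \|\lambda\|_{X^*}=1\}$, where $A(\lambda)=\sum_{i,j}a_{ij}\lambda(e_i)e_j$. The projective norm is $\|A\|_\pi=\inf\{\sum_{k=1}^N\|v_k\|\,\|w_k\| : A=\sum_{k=1}^N v_k\otimes w_k,\ v_k,w_k\in X,\ N\in\mathbb{N}\}$. The constant $\rho^+(X)$ is the smallest constant such that $\|A\|_\pi\le\rho^+(X)\|A\|_\epsilon$ for all $A\ge 0$ in $X\otimes X$. *)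

(* Defs.v *)
From HB Require Import structures.
From mathcomp Require Import all_boot all_order all_algebra.
From mathcomp Require Import all_classical all_reals all_analysis.

Set Implicit Arguments.
Unset Strict Implicit.
Unset Printing Implicit Defensive.

Import Order.TTheory GRing.Theory Num.Theory.
Import numFieldNormedType.Exports.

Local Open Scope classical_set_scope.
Local Open Scope ring_scope.

Definition lincomb (R : realType) (X : lmodType R) (n : nat)
    (e : 'I_n -> X) (a : 'rV[R]_n) : X :=
  \sum_(i < n) a 0 i *: e i.

(* The coordinate map is stored as data, but it is determined by the vectors. *)
Record basis (R : realType) (X : lmodType R) (n : nat) := Basis {
  basis_vec :> 'I_n -> X;
  coord : X -> 'rV[R]_n;
  lincombK : cancel (lincomb basis_vec) coord;
  coordK : cancel coord (lincomb basis_vec) }.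

(* An element of X (x) X is represented by its matrix (a_ij) of coefficients
   on the tensors e_i (x) e_j. *)
Definition tensor (R : realType) (X : lmodType R) (n : nat) (e : basis X n)
    (v w : X) : 'M[R]_n :=
  (coord e v)^T *m coord e w.

Definition nonneg_definite (R : realType) (n : nat) (A : 'M[R]_n) : Prop :=
  A^T = A /\ forall x : 'rV[R]_n, 0 <= (x *m A *m x^T) 0 0.

(* In finite dimension every linear functional is bounded, so that X^* consists
   of all linear functionals on X. *)
Definition dual_norm (R : realType) (X : normedModType R)
    (lam : {linear X -> R^o}) : R :=
  sup [set `|lam x : R| | x in [set x : X | `|x| <= 1]].

Definition tensor_eval (R : realType) (X : lmodType R) (n : nat)
    (e : basis X n) (A : 'M[R]_n) (lam : {linear X -> R^o}) : X :=
  \sum_(i < n) \sum_(j < n) (A i j * lam (e i)) *: e j.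

Definition injective_norm (R : realType) (X : normedModType R) (n : nat)
    (e : basis X n) (A : 'M[R]_n) : R :=
  sup [set `|tensor_eval e A lam| |
        lam in [set lam : {linear X -> R^o} | dual_norm lam = 1]].

Definition projective_norm (R : realType) (X : normedModType R) (n : nat)
    (e : basis X n) (A : 'M[R]_n) : R :=
  inf [set r : R | exists (N : nat) (v w : 'I_N -> X),
        A = \sum_(k < N) tensor e (v k) (w k) /\
        r = \sum_(k < N) `|v k| * `|w k|].

Definition rho_plus_bounds (R : realType) (X : normedModType R) (n : nat)
    (e : basis X n) : set R :=
  [set c | forall A : 'M[R]_n, nonneg_definite A ->
     projective_norm e A <= c * injective_norm e A].

Definition is_rho_plus (R : realType) (X : normedModType R) (n : nat)
    (e : basis X n) (c : R) : Prop :=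
  rho_plus_bounds e c /\ lbound (rho_plus_bounds e) c.

(* The norm of the library on row vectors is max_i |x_i|. *)
Definition linf (R : realType) (n : nat) : normedModType R := 'rV[R]_n.

Lemma linf_normE (R : realType) (n : nat) (x : linf R n) :
  `|x| = \big[Num.max/0]_(i < n) `|(x : 'rV[R]_n) 0 i|.
Proof.
rewrite [LHS]mx_normrE; apply/eqP; rewrite eq_le; apply/andP; split.
  apply/bigmax_leP; split=> [|[i j] _ /=]; first exact: bigmax_ge_id.
  by rewrite ord1; apply: (le_bigmax _ (fun j => `|(x : 'rV[R]_n) 0 j|)).
apply/bigmax_leP; split=> [|j _]; first exact: bigmax_ge_id.
exact: (le_bigmax _ (fun ij => `|(x : 'rV[R]_n) ij.1 ij.2|) (0, j)).
Qed.

Lemma lincomb_delta (R : realType) (n : nat) (a : 'rV[R]_n) :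
  lincomb (fun i : 'I_n => delta_mx 0 i : linf R n) a = a.
Proof. by rewrite [RHS]row_sum_delta. Qed.

Definition linf_basis (R : realType) (n : nat) : basis (linf R n) n :=
  @Basis R (linf R n) n (fun i => delta_mx 0 i) id
    (@lincomb_delta R n) (@lincomb_delta R n).

(* Main.v *)
(** By duality the injective norm of [A] over linf is [max |A i j|], hence the
    largest diagonal entry when [A >= 0].  With [d i = sqrt (A i i)], the matrix
    [A] is [D C D] where [C] is a correlation matrix, and a 3 x 3 symmetric
    matrix with unit diagonal is uniquely [\sum_k alpha_k s_k^T s_k] over the
    four sign vectors up to sign, with [\sum_k alpha_k = 1].  Positivity tested
    at the sign vectors gives [alpha_k >= -1/8], and positivity of the 2 x 2
    minors gives [alpha_k + alpha_l >= 0]; so at most one coefficient is negative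
    and [\sum_k |alpha_k| <= 5/4].  The matrix with off-diagonal entries [-1/2]
    is extremal, as one sees by pairing it with a bilinear form of norm 1. *)

From HB Require Import structures.
Require Import Defs.
From mathcomp Require Import all_boot all_order all_algebra.
From mathcomp Require Import all_classical all_reals all_analysis.
From mathcomp Require Import ring lra.

Set Implicit Arguments.
Unset Strict Implicit.
Unset Printing Implicit Defensive.

Import Order.TTheory GRing.Theory Num.Theory.
Import numFieldNormedType.Exports.

Local Open Scope classical_set_scope.
Local Open Scope ring_scope.

(** * Duality of the max norm with the l_1 norm, and the injective norm as the largest entry in
    modulus *)

Section InjectiveNorm.
Variables (R : realType) (n : nat).
Implicit Types (x : linf R n) (lam : {linear linf R n -> R^o}) (A : 'M[R]_n).

Lemma linf_coord_le x (i : 'I_n) : `|(x : 'rV[R]_n) 0 i| <= `|x|.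
Proof.
by rewrite linf_normE; apply: (le_bigmax _ (fun j => `|(x : 'rV[R]_n) 0 j|)).
Qed.

Lemma linf_norm_le x (M : R) : 0 <= M ->
  (forall i, `|(x : 'rV[R]_n) 0 i| <= M) -> `|x| <= M.
Proof. by move=> M0 xM; rewrite linf_normE; apply: bigmax_le. Qed.

Lemma functional_sum lam x :
  lam x = \sum_(i < n) (x : 'rV[R]_n) 0 i * lam (delta_mx 0 i).
Proof.
rewrite [in LHS](row_sum_delta (x : 'rV[R]_n)) (linear_sum lam).
by apply: eq_bigr => i _; rewrite linearZ.
Qed.

Lemma functional_le lam x : `|x| <= 1 -> `|lam x : R| <= dual_norm lam.
Proof.
move=> x1; apply: ub_le_sup; last by exists x.
(* The l_1 norm of the coefficients bounds the set, so its supremum is genuine and not a default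
   value. *)
exists (\sum_(i < n) `|lam (delta_mx 0 i) : R|) => _ [y /= y1 <-].
rewrite functional_sum (le_trans (ler_norm_sum _ _ _)) //.
apply: ler_sum => i _; rewrite normrM ler_piMl //.
exact: le_trans (linf_coord_le y i) y1.
Qed.

(** The sign vector of the coefficients lies in the unit ball, and there the functional takes their
    l_1 norm as value. *)
Lemma sum_functional_le lam :
  \sum_(i < n) `|lam (delta_mx 0 i) : R| <= dual_norm lam.
Proof.
pose x : linf R n := \row_i Num.sg (lam (delta_mx 0 i) : R).
have x1 : `|x| <= 1.
  by apply: linf_norm_le => // i; rewrite mxE normr_sg lern1 leq_b1.
apply: le_trans (le_trans (ler_norm _) (functional_le lam x1)).
rewrite functional_sum le_eqVlt; apply/orP; left; apply/eqP.
by apply: eq_bigr => i _; rewrite mxE -normrEsg.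
Qed.

Lemma tensor_eval_coord A lam (j : 'I_n) :
  (tensor_eval (linf_basis R n) A lam : 'rV[R]_n) 0 j =
  \sum_(i < n) A i j * lam (delta_mx 0 i).
Proof.
rewrite /tensor_eval summxE; apply: eq_bigr => i _.
rewrite summxE (bigD1 j) //= big1 ?addr0 => [|k kj].
  by rewrite !mxE !eqxx mulr1.
by rewrite !mxE (eq_sym j) (negbTE kj) andbF mulr0.
Qed.

Lemma tensor_eval_le A lam (M : R) : 0 <= M -> (forall i j, `|A i j| <= M) ->
  dual_norm lam = 1 -> `|tensor_eval (linf_basis R n) A lam| <= M.
Proof.
move=> M0 AM lam1; apply: linf_norm_le => // j.
rewrite tensor_eval_coord (le_trans (ler_norm_sum _ _ _)) //.
apply: (@le_trans _ _ (\sum_(i < n) M * `|lam (delta_mx 0 i) : R|)).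
  by apply: ler_sum => i _; rewrite normrM ler_wpM2r.
by rewrite -mulr_sumr ler_piMr // -lam1 sum_functional_le.
Qed.

Definition coord_functional (j : 'I_n) (x : linf R n) : R^o :=
  (x : 'rV[R]_n) 0 j.

Fact coord_functional_linear j : linear (coord_functional j).
Proof. by move=> a x y; rewrite /coord_functional !mxE. Qed.

HB.instance Definition _ j :=
  GRing.isLinear.Build R (linf R n) R^o *:%R (coord_functional j)
    (coord_functional_linear j).

Lemma dual_norm_coord j : dual_norm (coord_functional j) = 1.
Proof.
apply/le_anti/andP; split.
  apply: ge_sup => [|_ [x /= x1 <-]]; last exact: le_trans (linf_coord_le x j) x1.
  by exists `|coord_functional j 0|; exists 0 => //=; rewrite normr0.
have d1 : `|(delta_mx 0 j : linf R n)| <= 1.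
  apply: linf_norm_le => // i; rewrite mxE /=.
  by case: (_ == _); rewrite ?normr1 ?normr0.
have := functional_le (coord_functional j) d1.
by rewrite /= /coord_functional mxE !eqxx normr1.
Qed.

(** The [i]-th coordinate functional has dual norm 1 and sends the tensor to row [i] of [A]. *)
Lemma injective_norm_ge A i j :
  `|A i j| <= injective_norm (linf_basis R n) A.
Proof.
apply: (@le_trans _ _
    `|tensor_eval (linf_basis R n) A (coord_functional i)|).
  have := linf_coord_le (tensor_eval (linf_basis R n) A (coord_functional i)) j.
  rewrite tensor_eval_coord (bigD1 i) //= big1 => [|k ki].
    by rewrite /coord_functional mxE !eqxx mulr1 addr0.
  by rewrite /coord_functional mxE (eq_sym i) (negbTE ki) andbF mulr0.
apply: ub_le_sup; last by exists (coord_functional i) => //=; apply: dual_norm_coord.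
exists (\sum_k \sum_l `|A k l|) => _ [lam /= lam1 <-].
apply: tensor_eval_le => // [|k l].
  by apply: sumr_ge0 => k _; apply: sumr_ge0.
rewrite (bigD1 k) //= (bigD1 l) //= -addrA lerDl addr_ge0 ?sumr_ge0 // => k' _.
exact: sumr_ge0.
Qed.

Lemma injective_norm_le A (M : R) : 0 <= M ->
  (forall i j, `|A i j| <= M) -> injective_norm (linf_basis R n) A <= M.
Proof.
move=> M0 AM; rewrite /injective_norm; set S := (X in sup X).
(* In dimension 0 no functional has dual norm 1; the supremum is then 0 by convention. *)
have [->|/set0P S0] := eqVneq S set0; first by rewrite sup0.
by apply: ge_sup => // _ [lam /= lam1 <-]; apply: tensor_eval_le.
Qed.

End InjectiveNorm.

(** * Projective norm: upper bounds from decompositions, lower bounds by duality *)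

Section ProjectiveNorm.
Variables (R : realType) (n : nat).
Implicit Types (A B : 'M[R]_n).

Lemma projective_norm_le A (N : nat) (v w : 'I_N -> linf R n) :
  A = \sum_(k < N) tensor (linf_basis R n) (v k) (w k) ->
  projective_norm (linf_basis R n) A <= \sum_(k < N) `|v k| * `|w k|.
Proof.
move=> AE; apply: ge_inf; last by exists N, v, w.
by exists 0 => _ [N' [v' [w' [_ ->]]]]; apply: sumr_ge0 => k _; rewrite mulr_ge0.
Qed.

(** With D the diagonal matrix of [d], [A] is the sum of the alpha_k (D s_k) (x) (D s_k). Each D s_k
    has norm at most sqrt M, so the k-th term costs at most |alpha_k| M. *)
Lemma projective_norm_scaled_le A (N : nat) (alpha : 'I_N -> R)
    (s : 'I_N -> 'I_n -> R) (d : 'I_n -> R) (M c : R) :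
  0 <= M -> (forall i, d i ^+ 2 <= M) -> (forall k i, `|s k i| <= 1) ->
  (forall i j, A i j = d i * d j * \sum_(k < N) alpha k * (s k i * s k j)) ->
  \sum_(k < N) `|alpha k| <= c ->
  projective_norm (linf_basis R n) A <= c * M.
Proof.
move=> M0 dM s1 AE alphac.
pose v k : linf R n := \row_i (alpha k * (d i * s k i)).
pose w k : linf R n := \row_i (d i * s k i).
have ds k i : `|d i * s k i| <= Num.sqrt M.
  rewrite normrM -[leRHS]mulr1 ler_pM // -sqrtr_sqr ler_sqrt //.
have /projective_norm_le/le_trans : A = \sum_(k < N) tensor (linf_basis R n) (v k) (w k).
  apply/matrixP => i j; rewrite AE summxE mulr_sumr; apply: eq_bigr => k _.
  by rewrite /tensor !mxE big_ord1 !mxE; ring.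
apply; apply: (@le_trans _ _ (\sum_(k < N) `|alpha k| * M)); last first.
  by rewrite -mulr_suml ler_wpM2r.
apply: ler_sum => k _; rewrite -[in leRHS](sqr_sqrtr M0) expr2 mulrA ler_pM //.
  apply: linf_norm_le => [|i]; first by rewrite mulr_ge0 ?sqrtr_ge0.
  by rewrite mxE normrM ler_wpM2l.
by apply: linf_norm_le => [|i]; rewrite ?sqrtr_ge0 // mxE.
Qed.

(** A bilinear form of norm at most 1 is bounded on every decomposition of [A] by its cost, and its
    value depends on [A] alone. *)
Lemma projective_norm_ge A B :
  (forall v w : linf R n,
     \sum_i \sum_j B i j * ((v : 'rV[R]_n) 0 i * (w : 'rV[R]_n) 0 j)
       <= `|v| * `|w|) ->
  \sum_i \sum_j B i j * A i j <= projective_norm (linf_basis R n) A.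
Proof.
move=> Bvw; apply: lb_le_inf.
  (* The infimum needs one decomposition to exist: [A] is the sum of e_k (x) (row k of [A]). *)
  pose v (k : 'I_n) : linf R n := delta_mx 0 k.
  pose w (k : 'I_n) : linf R n := row k A.
  exists (\sum_(k < n) `|v k| * `|w k|), n, v, w; split=> //.
  apply/matrixP => i j; rewrite summxE (bigD1 i) //= big1 => [|k ki].
    by rewrite /tensor mxE big_ord1 !mxE !eqxx mul1r addr0.
  by rewrite /tensor mxE big_ord1 !mxE (eq_sym i) (negbTE ki) mul0r.
move=> _ [N [v [w [-> ->]]]].
have -> : \sum_i \sum_j B i j *
    (\sum_(k < N) tensor (linf_basis R n) (v k) (w k)) i j =
  \sum_(k < N) \sum_i \sum_j
    B i j * ((v k : 'rV[R]_n) 0 i * (w k : 'rV[R]_n) 0 j).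
  rewrite [RHS]exchange_big /=; apply: eq_bigr => i _.
  rewrite [RHS]exchange_big /=; apply: eq_bigr => j _.
  rewrite summxE mulr_sumr; apply: eq_bigr => k _.
  by rewrite /tensor mxE big_ord1 !mxE.
by apply: ler_sum => k _; apply: Bvw.
Qed.

End ProjectiveNorm.

(** * Non-negative definite matrices and their normalisation to correlation matrices *)

Section NonnegDefinite.
Variables (R : realType) (n : nat) (A : 'M[R]_n).
Hypothesis A_ge0 : nonneg_definite A.

Lemma nonneg_definite_sym i j : A i j = A j i.
Proof. by case: A_ge0 => AT _; rewrite -[in LHS]AT mxE. Qed.

Lemma nonneg_definite_form (u : 'I_n -> R) :
  0 <= \sum_i \sum_j u i * u j * A i j.
Proof.
have /(_ (\row_i u i)) := A_ge0.2; congr (0 <= _).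
rewrite mxE exchange_big /=; apply: eq_bigr => j _.
rewrite !mxE mulr_suml; apply: eq_bigr => i _.
by rewrite !mxE; ring.
Qed.

Lemma nonneg_definite_form2 i j (t u : R) : i != j ->
  0 <= t ^+ 2 * A i i + 2 * (t * u * A i j) + u ^+ 2 * A j j.
Proof.
move=> ij; pose w k := if k == i then t else if k == j then u else 0.
have w_sum (F : 'I_n -> R) : \sum_k w k * F k = t * F i + u * F j.
  rewrite (bigD1 i) //= (bigD1 j) 1?eq_sym //= big1; last first.
    by move=> k /andP[ki kj]; rewrite /w (negbTE ki) (negbTE kj) mul0r.
  by rewrite /w !eqxx (eq_sym j) (negbTE ij) addr0.
have := nonneg_definite_form w.
under eq_bigr => k _ do
  (under eq_bigr => l _ do rewrite -mulrA; rewrite -mulr_sumr w_sum).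
by rewrite w_sum (nonneg_definite_sym j i); congr (0 <= _); ring.
Qed.

Lemma nonneg_definite_diag i : 0 <= A i i.
Proof.
have := nonneg_definite_form (fun k => (k == i)%:R).
rewrite (bigD1 i) //= [X in _ + X]big1 ?addr0; last first.
  by move=> k /negbTE->; apply: big1 => l _; rewrite !mul0r.
rewrite (bigD1 i) //= [X in _ + X]big1 ?addr0 ?eqxx ?mul1r //.
by move=> k /negbTE->; rewrite mulr0 mul0r.
Qed.

Lemma nonneg_definite_diag_eq0 i j : A i i = 0 -> A i j = 0.
Proof.
have [->//|ij] := eqVneq i j => Aii.
(* With a = A i j, b = A j j and A i i = 0, the form at (-(b + 1), a) equals -(b + 2) a^2, which
   forces a = 0. *)
have := nonneg_definite_form2 (- (A j j + 1)) (A i j) ij.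
have Ajj := nonneg_definite_diag j.
rewrite Aii; set a := A i j; set b := A j j => h.
have : (b + 2) * a ^+ 2 <= 0 by move: h; nra.
rewrite pmulr_rle0 ?ltr_wpDl // => a2.
by apply/eqP; rewrite -sqrf_eq0; apply/eqP/le_anti; rewrite a2 sqr_ge0.
Qed.

Definition diag_sqrt i : R := Num.sqrt (A i i).

(* Junk inverses make the rows with zero diagonal entry vanish here. *)
Definition correlation i j : R := (diag_sqrt i)^-1 * (diag_sqrt j)^-1 * A i j.

Lemma diag_sqrt_eq0 i : diag_sqrt i = 0 -> A i i = 0.
Proof.
move=> d0; apply/le_anti; rewrite nonneg_definite_diag andbT.
by rewrite -sqrtr_eq0; apply/eqP.
Qed.

(** A zero diagonal entry kills its row and column of [A], so the factorisation survives the junk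
    inverses. *)
Lemma correlationE i j : A i j = diag_sqrt i * diag_sqrt j * correlation i j.
Proof.
have [/diag_sqrt_eq0 Aii|di] := eqVneq (diag_sqrt i) 0.
  by rewrite /correlation nonneg_definite_diag_eq0 // !mulr0.
have [/diag_sqrt_eq0 Ajj|dj] := eqVneq (diag_sqrt j) 0.
  by rewrite /correlation nonneg_definite_sym nonneg_definite_diag_eq0 // !mulr0.
by rewrite /correlation; field; rewrite di dj.
Qed.

Lemma correlation_sym i j : correlation i j = correlation j i.
Proof. by rewrite /correlation nonneg_definite_sym; ring. Qed.

Lemma correlation_diag i : correlation i i <= 1.
Proof.
rewrite /correlation; have [->|di] := eqVneq (diag_sqrt i) 0.
  by rewrite invr0 !mul0r ler01.
rewrite -(sqr_sqrtr (nonneg_definite_diag i)) -/(diag_sqrt i).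
by rewrite le_eqVlt; apply/orP; left; apply/eqP; field.
Qed.

Lemma correlation_form (u : 'I_n -> R) :
  0 <= \sum_i \sum_j u i * u j * correlation i j.
Proof.
have := nonneg_definite_form (fun i => u i * (diag_sqrt i)^-1).
congr (0 <= _); apply: eq_bigr => i _; apply: eq_bigr => j _.
by rewrite /correlation; ring.
Qed.

Lemma correlation_le1 i j : i != j -> `|correlation i j| <= 1.
Proof.
move=> ij; set c := correlation i j.
have form2 (e : R) : e ^+ 2 = 1 -> 0 <= 2 + 2 * (e * c).
  move=> e1.
  (* At this vector the two diagonal terms contribute at most 1 each. *)
  have := nonneg_definite_form2 (diag_sqrt i)^-1 (e * (diag_sqrt j)^-1) ij.
  have := correlation_diag i; have := correlation_diag j.
  rewrite /c /correlation exprMn e1 mul1r !expr2.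
  set p := _ * A j j; set q := _ * A i i => p1 q1.
  have -> : (diag_sqrt i)^-1 * (e * (diag_sqrt j)^-1) * A i j =
     e * ((diag_sqrt i)^-1 * (diag_sqrt j)^-1 * A i j) by ring.
  lra.
have := form2 1 (expr1n _ _); have : (-1 : R) ^+ 2 = 1 by rewrite sqrrN expr1n.
by move=> /form2; rewrite ler_norml => ? ?; apply/andP; split; lra.
Qed.

End NonnegDefinite.

(** * Upper bounds from sign-vector decompositions, lower bounds from extremal tensors *)

Section RhoPlus.
Variable R : realType.

(** Matching [correlation] off the diagonal suffices: on it, signs square to 1 and the alpha_k sum
    to 1, which gives [A i i] even where [correlation A i i] is 0. *)
Lemma projective_norm_correlation_le (n N : nat) (A : 'M[R]_n.+1)
    (alpha : 'I_N -> R) (s : 'I_N -> 'I_n.+1 -> R) (c : R) :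
  nonneg_definite A -> (forall k i, s k i ^+ 2 = 1) ->
  (forall i j, i != j -> correlation A i j = \sum_k alpha k * (s k i * s k j)) ->
  \sum_k alpha k = 1 -> \sum_k `|alpha k| <= c ->
  projective_norm (linf_basis R n.+1) A <=
    c * injective_norm (linf_basis R n.+1) A.
Proof.
move=> A0 s1 CE alpha1 alphac.
have dA i : diag_sqrt A i ^+ 2 = A i i.
  exact/sqr_sqrtr/nonneg_definite_diag.
apply: (projective_norm_scaled_le (d := diag_sqrt A) (alpha := alpha) (s := s)).
- exact: le_trans (normr_ge0 _) (injective_norm_ge A ord0 ord0).
- by move=> i; rewrite dA (le_trans (ler_norm _)) ?injective_norm_ge.
- by move=> k i; rewrite -(@expr_le1 _ 2) // real_normK ?num_real ?s1.
- move=> i j; have [<-|ij] := eqVneq i j.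
    rewrite -expr2 dA; under eq_bigr => k _ do rewrite -expr2 s1 mulr1.
    by rewrite alpha1 mulr1.
  by rewrite -CE // -correlationE.
- exact: alphac.
Qed.

Lemma rho_plus_linf2_le : rho_plus_bounds (linf_basis R 2) 1.
Proof.
move=> A A0; pose x := correlation A ord0 ord_max.
have := correlation_le1 A0 (isT : (ord0 : 'I_2) != ord_max).
rewrite -/x ler_norml => /andP[x_ge x_le].
(* The sign vectors (1, 1) and (1, -1); the weights below are non-negative as |x| <= 1. *)
pose s (k i : 'I_2) : R := (-1) ^+ (k + i == 2)%N.
pose alpha (k : 'I_2) : R := nth 0 [:: (1 + x) / 2; (1 - x) / 2] k.
apply: (projective_norm_correlation_le (alpha := alpha) (s := s)) => //.
- by move=> k i; rewrite sqrr_sign.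
- suff off (i j : 'I_2) : (i < j)%N ->
      correlation A i j = \sum_k alpha k * (s k i * s k j).
    move=> i j; rewrite neq_ltn => /orP[|] ij; first exact: off.
    by rewrite (correlation_sym A0) off //; apply: eq_bigr => k _; ring.
  case: i j => [[|[|//]] i] [[|[|//]] j] //= _.
  rewrite !big_ord_recl big_ord0 /alpha /s /=.
  transitivity x; last by rewrite /bump /=; field.
  by congr (correlation A _ _); apply: val_inj.
- by rewrite !big_ord_recl big_ord0 /alpha /=; field.
- rewrite !big_ord_recl big_ord0 /alpha /= !ger0_norm; lra.
Qed.

Lemma rho_plus_linf3_le : rho_plus_bounds (linf_basis R 3) (5 / 4).
Proof.
move=> A A0; pose o1 : 'I_3 := inord 1.
pose x := correlation A ord0 o1; pose y := correlation A ord0 ord_max.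
pose z := correlation A o1 ord_max.
have o1E : o1 = lift ord0 ord0 by apply: val_inj; rewrite /= inordK.
have := correlation_le1 A0 (_ : (ord0 : 'I_3) != o1).
have := correlation_le1 A0 (_ : (ord0 : 'I_3) != ord_max).
have := correlation_le1 A0 (_ : o1 != ord_max).
(* Only the occurrences in the disequalities are rewritten, so that these hold by computation. *)
rewrite {1 3}o1E -/x -/y -/z !ler_norml.
move=> /(_ isT)/andP[z_ge z_le] /(_ isT)/andP[y_ge y_le] /(_ isT)/andP[x_ge x_le].
have form a b c : a ^+ 2 = 1 -> b ^+ 2 = 1 -> c ^+ 2 = 1 ->
    0 <= 3 + 2 * (a * b * x + a * c * y + b * c * z).
  move=> a1 b1 c1.
  have := correlation_form A0 (fun i => nth 0 [:: a; b; c] i).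
  rewrite !big_ord_recl !big_ord0 /= -o1E.
  have -> : lift ord0 (lift ord0 ord0) = ord_max :> 'I_3 by apply: val_inj.
  rewrite -!expr2 a1 b1 c1 !(correlation_sym A0 _ ord0).
  rewrite (correlation_sym A0 ord_max o1) -/x -/y -/z.
  have := correlation_diag A0 ord0; have := correlation_diag A0 o1.
  have := correlation_diag A0 ord_max; lra.
have N1 : (-1 : R) ^+ 2 = 1 by rewrite sqrrN expr1n.
have := form _ _ _ (expr1n _ 2) (expr1n _ 2) (expr1n _ 2).
have := form _ _ _ (expr1n _ 2) (expr1n _ 2) N1.
have := form _ _ _ (expr1n _ 2) N1 (expr1n _ 2).
have := form _ _ _ N1 (expr1n _ 2) (expr1n _ 2) => f3 f2 f1 f0.
(* Vector 0 is (1, 1, 1); vector k > 0 has its only -1 at index 3 - k. The coefficients solve a 4 x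
   4 Hadamard system, and the inequality [fk] says alpha_k >= -1/8. *)
pose s (k : 'I_4) (i : 'I_3) : R := (-1) ^+ (k + i == 3)%N.
pose alpha (k : 'I_4) : R := nth 0 [:: (1 + x + y + z) / 4;
  (1 + x - y - z) / 4; (1 - x + y - z) / 4; (1 - x - y + z) / 4] k.
apply: (projective_norm_correlation_le (alpha := alpha) (s := s)) => //.
- by move=> k i; rewrite sqrr_sign.
- suff off (i j : 'I_3) : (i < j)%N ->
      correlation A i j = \sum_k alpha k * (s k i * s k j).
    move=> i j; rewrite neq_ltn => /orP[|] ij; first exact: off.
    by rewrite (correlation_sym A0) off //; apply: eq_bigr => k _; ring.
  rewrite !big_ord_recl big_ord0 /alpha /s /=.
  case: i j => [[|[|[|//]]] i] [[|[|[|//]]] j] //= _.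
  + transitivity x; last by rewrite /bump /=; field.
    by congr (correlation A _ _); apply: val_inj; rewrite ?o1E.
  + transitivity y; last by rewrite /bump /=; field.
    by congr (correlation A _ _); apply: val_inj.
  + transitivity z; last by rewrite /bump /=; field.
    by congr (correlation A _ _); apply: val_inj; rewrite ?o1E.
- by rewrite !big_ord_recl big_ord0 /alpha /=; field.
rewrite !big_ord_recl big_ord0 /alpha /=.
(* Two negative coefficients are impossible, as any two sum to (1 + t) / 2 or (1 - t) / 2 with t
   among x, y, z. If only alpha_k is negative, the absolute values sum to 1 - 2 alpha_k <= 5/4. *)
case: (ger0P ((1 + x + y + z) / 4)) => ?;
case: (ger0P ((1 + x - y - z) / 4)) => ?;
case: (ger0P ((1 - x + y - z) / 4)) => ?;
case: (ger0P ((1 - x - y + z) / 4)) => ?; lra.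
Qed.

Lemma rho_plus_linf2_ge : lbound (rho_plus_bounds (linf_basis R 2)) 1.
Proof.
move=> c; pose A : 'M[R]_2 := delta_mx 0 0 => /(_ A).
have form (F : 'I_2 -> 'I_2 -> R) : \sum_i \sum_j A i j * F i j = F 0 0.
  rewrite (bigD1 0) //= [X in _ + X]big1 ?addr0; last first.
    by move=> i i0; apply: big1 => j _; rewrite mxE (negbTE i0) mul0r.
  rewrite (bigD1 0) //= big1 ?addr0 ?mxE ?mul1r // => j j0.
  by rewrite mxE (negbTE j0) andbF mul0r.
have A0 : nonneg_definite A.
  split=> [|u]; first by rewrite trmx_delta.
  rewrite !mxE !big_ord_recl big_ord0 !mxE !big_ord_recl !big_ord0 !mxE /=.
  by have := sqr_ge0 (u 0 0); rewrite expr2; lra.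
have inj1 : injective_norm (linf_basis R 2) A = 1.
  apply/le_anti; rewrite injective_norm_le //=; last first.
    by move=> i j; rewrite mxE; case: (_ && _); rewrite ?normr1 ?normr0.
  by have := injective_norm_ge A 0 0; rewrite mxE normr1.
(* [A] also serves as the dual form v_0 w_0, of norm at most 1, whose value on the tensor is 1. *)
have := @projective_norm_ge _ _ A A; rewrite form mxE => proj1.
move=> /(_ A0); rewrite inj1 mulr1; apply: le_trans; apply: proj1 => v w.
rewrite form (le_trans (ler_norm _)) // normrM.
by rewrite ler_pM // linf_coord_le.
Qed.

(* The coefficients [1/6] and [-1/4] are those for which the form takes the
   values [-1] at [s = t = (1, 1, 1)] and [1] at [s = t = (1, 1, -1)], the sign
   vectors that occur in an optimal decomposition of the matrix with
   diagonal [1] and off-diagonal [-1/2]. *)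
Lemma extremal_form_le (v w : linf R 3) :
  \sum_i \sum_j (if i == j then 6^-1 else - 4^-1) *
    ((v : 'rV[R]_3) 0 i * (w : 'rV[R]_3) 0 j) <= `|v| * `|w|.
Proof.
have vle i := linf_coord_le v i; have wle i := linf_coord_le w i.
(* For fixed v the form is linear in w with coefficients [L], so it remains to bound the l_1 norm of
   [L] by |v|. *)
pose L j : R := \sum_i (if i == j then 6^-1 else - 4^-1) * (v : 'rV[R]_3) 0 i.
apply: (@le_trans _ _ (\sum_j `|L j| * `|w|)).
  rewrite exchange_big; apply: ler_sum => j _ /=.
  rewrite (eq_bigr _ (fun i _ => mulrA _ _ _)) -mulr_suml.
  by rewrite (le_trans (ler_norm _)) // normrM ler_wpM2l.
rewrite -mulr_suml ler_wpM2r // !big_ord_recl !big_ord0.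
rewrite /L !big_ord_recl !big_ord0 /=.
move: (vle ord0) (vle (lift ord0 ord0)) (vle (lift ord0 (lift ord0 ord0))).
rewrite !ler_norml => /andP[? ?] /andP[? ?] /andP[? ?].
(* Once the signs of the three [L j] are fixed, the inequality is linear in |v| and the coordinates
   of v. *)
by do 3!(case: (ger0P (_ + _)) => ?); lra.
Qed.

Lemma rho_plus_linf3_ge : lbound (rho_plus_bounds (linf_basis R 3)) (5 / 4).
Proof.
move=> c; pose A : 'M[R]_3 := \matrix_(i, j) if i == j then 1 else - 2^-1.
move=> /(_ A).
have A0 : nonneg_definite A.
  split=> [|u]; first by apply/matrixP => i j; rewrite !mxE eq_sym.
  rewrite !mxE !big_ord_recl big_ord0 !mxE !big_ord_recl !big_ord0 !mxE /=.
  set a := u _ _; set b := u _ _; set d := u _ _.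
  (* The quadratic form is half the sum of these squares. *)
  have := sqr_ge0 (a - b); have := sqr_ge0 (a - d); have := sqr_ge0 (b - d).
  by rewrite !expr2; lra.
have inj1 : injective_norm (linf_basis R 3) A <= 1.
  apply: injective_norm_le => // i j; rewrite mxE.
  by case: eqP => _; rewrite ?normr1 // normrN ger0_norm; lra.
have inj1' : 1 <= injective_norm (linf_basis R 3) A.
  by have := injective_norm_ge A 0 0; rewrite mxE eqxx normr1.
have {inj1 inj1'} -> : injective_norm (linf_basis R 3) A = 1.
  by apply/le_anti; rewrite inj1.
move=> /(_ A0); rewrite mulr1; apply: le_trans.
pose B : 'M[R]_3 := \matrix_(i, j) if i == j then 6^-1 else - 4^-1.
have := @projective_norm_ge _ _ A B.
rewrite !big_ord_recl !big_ord0 !mxE /=.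
(* The pairing is 3 * 1/6 from the diagonal plus 6 * 1/4 * 1/2 off it. *)
rewrite (_ : _ + _ = 5 / 4); last by field.
apply=> v w; apply: le_trans (extremal_form_le v w).
rewrite le_eqVlt; apply/orP; left; apply/eqP.
by do 2!apply: eq_bigr => ? _; rewrite mxE.
Qed.

End RhoPlus.

Theorem theorem3p4 (R : realType) :
  is_rho_plus (linf_basis R 2) 1 /\ is_rho_plus (linf_basis R 3) (5 / 4).
Proof.
split; split.
- exact: rho_plus_linf2_le.
- exact: rho_plus_linf2_ge.
- exact: rho_plus_linf3_le.
- exact: rho_plus_linf3_ge.
Qed.
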